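(* Let $\Sigma=\{a,b\}$, let $w\in\Sigma^{*}$ be a nonempty word of length $|w|=n$ with $w\notin\{a^{n-1}b,\ ab^{n-1},\ ba^{n-1},\ b^{n-1}a\}$, and let $L=\Sigma^{*}w\Sigma^{*}$. Then $$\sigma(L)=n^2+1+N(w).$$
   Context: For a language $L\subseteq\Sigma^{*}$ the syntactic (Myhill) congruence $\approx_L$ is defined by: $u\approx_L v$ if and only if for all $x,y\in\Sigma^{*}$ one has $xuy\in L\Leftrightarrow xvy\in L$. The syntactic semigroup of $L$ is the quotient $\Sigma^{+}/{\approx_L}$, where $\Sigma^{+}$ is the semigroup of nonempty words over $\Sigma$ (the empty word is not included). The syntactic complexity $\sigma(L)$ of a regular language $L$ is the cardinality of its syntactic semigroup. A word $u\in\Sigma^{+}$ is an inner factor of $w$ if there exist words $t,s\in\Sigma^{+}$ (both nonempty) such that $w=tus$. $N(w)$ denotes the number of different (distinct as words) inner factors of $w$. *)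

(* Defs.v *)
From HB Require Import structures.
From mathcomp Require Import all_boot finmap.
From mathcomp Require Import boolp classical_sets cardinality.

Set Implicit Arguments.
Unset Strict Implicit.
Unset Printing Implicit Defensive.

Local Open Scope classical_set_scope.
Local Open Scope card_scope.
Local Open Scope quotient_scope.

(* Words over Sigma are sequences, and languages are sets of words. *)

Definition synt_congr (Sigma : finType) (L : set (seq Sigma))
    (u v : seq Sigma) : Prop :=
  forall x y : seq Sigma, L (x ++ u ++ y) <-> L (x ++ v ++ y).

Definition nword (Sigma : finType) := {u : seq Sigma | u != [::]}.

Section FreeSemigroup.
Variable Sigma : finType.

HB.instance Definition _ := Choice.on (nword Sigma).

Lemma nword_cat_subproof (u v : nword Sigma) : val u ++ val v != [::].
Proof. by case: u => -[]. Qed.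

Definition nword_cat (u v : nword Sigma) : nword Sigma :=
  exist _ (val u ++ val v) (nword_cat_subproof u v).

Lemma nword_catA : associative nword_cat.
Proof. by move=> u v w; apply: val_inj; rewrite /= catA. Qed.

HB.instance Definition _ := isSemigroup.Build (nword Sigma) nword_catA.

End FreeSemigroup.

Section SyntacticSemigroup.
Variables (Sigma : finType) (L : set (seq Sigma)).

(* [generic_quotient] needs a boolean relation, hence the classical [asbool]. *)
Definition synt_rel : rel (nword Sigma) :=
  fun u v => `[< synt_congr L (val u) (val v) >].

Lemma synt_rel_equiv : equiv_class_of synt_rel.
Proof.
split=> [u|u v|v u w]; first exact/asboolP.
- by apply/asboolP/asboolP => uv x y; apply: iff_sym.
- by move=> /asboolP uv /asboolP vw; apply/asboolP => x y; apply: iff_trans.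
Qed.

Canonical synt_equiv := EquivRelPack synt_rel_equiv.

Definition synt_semigroup := {eq_quot synt_rel}.

HB.instance Definition _ := Choice.on synt_semigroup.
HB.instance Definition _ := Quotient.on synt_semigroup.
HB.instance Definition _ : EqQuotient _ synt_rel synt_semigroup :=
  EqQuotient.on synt_semigroup.

Lemma synt_congr_cat (u u' v v' : seq Sigma) :
  synt_congr L u u' -> synt_congr L v v' -> synt_congr L (u ++ v) (u' ++ v').
Proof.
move=> uu' vv' x y; rewrite -!catA; apply: (iff_trans (uu' x (v ++ y))).
by rewrite !(catA x); apply: vv'.
Qed.

Definition synt_mul (c d : synt_semigroup) : synt_semigroup :=
  \pi_synt_semigroup (nword_cat (repr c) (repr d)).

Lemma pi_synt_mul (u v : nword Sigma) :
  synt_mul (\pi u) (\pi v) = \pi_synt_semigroup (nword_cat u v).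
Proof.
apply/(eqquotP synt_semigroup)/asboolP; apply: synt_congr_cat; apply/asboolP.
  by apply/(eqquotP synt_semigroup); rewrite reprK.
by apply/(eqquotP synt_semigroup); rewrite reprK.
Qed.

Lemma synt_mulA : associative synt_mul.
Proof.
elim/quotW=> u; elim/quotW=> v; elim/quotW=> w.
by rewrite !pi_synt_mul nword_catA.
Qed.

HB.instance Definition _ := isSemigroup.Build synt_semigroup synt_mulA.

End SyntacticSemigroup.

(* sigma(L) = k; in particular the syntactic semigroup is finite. *)
Definition synt_complexity (Sigma : finType) (L : set (seq Sigma)) (k : nat) :
    Prop :=
  [set: synt_semigroup L] #= `I_k.

Section InnerFactors.
Variable Sigma : finType.

Definition inner_factor (w u : seq Sigma) : Prop :=
  u != [::] /\
  exists t s : seq Sigma, [/\ t != [::], s != [::] & w = t ++ u ++ s].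

Lemma finite_inner_factor (w : seq Sigma) : finite_set (inner_factor w).
Proof.
apply: (@sub_finite_set _ _
  [set` [seq take i (drop j w) | i <- iota 0 (size w).+1,
                                 j <- iota 0 (size w).+1]]); last first.
  exact: finite_seq.
move=> u [_ [t [s [_ _ ->]]]]; apply/allpairsPdep.
exists (size u), (size t); rewrite !mem_iota !size_cat /= !add0n !ltnS; split.
- by rewrite addnCA leq_addr.
- exact: leq_addr.
- by rewrite drop_size_cat // take_size_cat.
Qed.

(* The value is not the default one of [fset_set], by [finite_inner_factor]. *)
Definition num_inner_factors (w : seq Sigma) : nat :=
  #|` fset_set [set u | inner_factor w u]|.

End InnerFactors.

Definition factor_language (Sigma : finType) (w : seq Sigma) :
    set (seq Sigma) :=
  [set u | exists x y : seq Sigma, u = x ++ w ++ y].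

(* Main.v *)
(* For a word u avoiding w, let i be the length of the longest proper suffix of
   w that is a prefix of u, and j the length of the longest proper prefix of w
   that is a suffix of u. Then x u contains w iff x followed by the suffix of w
   of length i does, and symmetrically for u y with j; so i and j depend only
   on the class of u. Unless u is an inner factor, every occurrence of w in
   x u y lies in x u or in u y, so (i, j) determines the class of u; each inner
   factor is alone in its class. Each pair (i, j) with i, j < n is realised by
   a word (suffix of length i) z (prefix of length j) too long to be an inner
   factor, where z separates the two ends without creating a longer overlap or
   an occurrence of w. If w begins with c and ends with d, take z = e^n with
   e <> c when c = d, and otherwise z = c^n d^n or z = c^n d c d^n: the factors
   of c^n d^n that start with c and end with d are the c^k d^l, and such a word
   is a factor of c^n d c d^n only when k = 1 or l = 1, which the theorem
   excludes. With the class of the words containing w this gives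
   n^2 + N(w) + 1 classes. *)

Require Import Defs.
From HB Require Import structures.
From mathcomp Require Import all_boot finmap zify.
From mathcomp Require Import boolp classical_sets cardinality.

Set Implicit Arguments.
Unset Strict Implicit.
Unset Printing Implicit Defensive.

(** * Overlaps with [w] and occurrences of [w] in concatenations *)

Section Overlap.
Variable T : eqType.
Implicit Types w u v x y p q r : seq T.

(* Being maxima over k < size w, these only count proper suffixes (prefixes)
   of w. *)
Definition tail_overlap w u : nat :=
  \max_(k < size w | take k u == drop (size w - k) w) k.

Definition head_overlap w u : nat := tail_overlap (rev w) (rev u).

(** Levi's lemma. *)
Lemma eq_cat_split x u p r : x ++ u = p ++ r ->
  (exists2 t, x = p ++ t & r = t ++ u) \/ (exists2 t, p = x ++ t & u = t ++ r).
Proof.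
elim: x p => [|c x IHx] [|d p] /= E.
- by left; exists [::].
- by right; exists (d :: p).
- by left; exists (c :: x).
case: E => -> /IHx[[t -> ->]|[t -> ->]]; [left|right]; by exists t.
Qed.

Lemma infix_size_eq w u : infix w u -> size u <= size w -> w = u.
Proof.
case/infixP => p [q ->]; rewrite !size_cat => p_q.
have [-> ->] : p = [::] /\ q = [::] by split; apply: size0nil; lia.
by rewrite cats0.
Qed.

Lemma tail_overlap_lt w u : w != [::] -> tail_overlap w u < size w.
Proof.
case: w => // c w _; rewrite /tail_overlap ltnS.
by apply/bigmax_leqP => k _; rewrite -ltnS.
Qed.

Lemma tail_overlap_max w u k : k < size w ->
  take k u = drop (size w - k) w -> k <= tail_overlap w u.
Proof.
move=> k_w /eqP E; exact: (@leq_bigmax_cond _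
  (fun k : 'I_(size w) => take k u == drop (size w - k) w) _ (Ordinal k_w)).
Qed.

Lemma take_tail_overlap w u : w != [::] ->
  take (tail_overlap w u) u = drop (size w - tail_overlap w u) w.
Proof.
move=> w0; rewrite /tail_overlap.
have w_gt0 : 0 < size w by case: w w0.
case: (@eq_bigmax_cond _ [pred k : 'I_(size w) |
    take k u == drop (size w - k) w] (fun k => k)).
  (* The index 0 always qualifies, so the maximum ranges over a nonempty set and is attained. *)
  apply/card_gt0P; exists (Ordinal w_gt0).
  by rewrite inE /= take0 subn0 drop_size.
by move=> k; rewrite inE => /eqP E /= ->.
Qed.

(** An occurrence of [w] in [x ++ u] starts inside [x]. If it runs into [u], the part in [u] is a
    proper suffix of [w] and a prefix of [u], hence a prefix of the longest overlap. *)
Lemma infix_catl w x u : w != [::] -> ~~ infix w u ->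
  infix w (x ++ u) = infix w (x ++ drop (size w - tail_overlap w u) w).
Proof.
move=> w0 Nwu; apply/idP/idP; last first.
  move=> /infix_trans; apply; rewrite -take_tail_overlap //; apply/infixP.
  by exists [::], (drop (tail_overlap w u) u); rewrite /= -catA cat_take_drop.
case/infixP => p [q] /eq_cat_split[[t -> E]|[t _ E]]; last first.
  by case/negP: Nwu; rewrite E; apply/infixP; exists t, q.
case: (eq_cat_split E) => -[s Es Eu]; last first.
  rewrite Es; apply/infixP; exists p, (s ++ drop (size w - tail_overlap w u) w).
  by rewrite -!catA.
case: t Es E => [|c t] Es E.
  by case/negP: Nwu; rewrite Eu Es; apply/infixP; exists [::], q.
have smax : size s <= tail_overlap w u.
  apply: tail_overlap_max; first by rewrite Es size_cat /=; lia.
  by rewrite {1}Eu take_size_cat // Es size_cat addnK drop_size_cat.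
apply/infixP; exists p, (drop (size s) (drop (size w - tail_overlap w u) w)).
rewrite -take_tail_overlap // -catA -{1}(cat_take_drop (size s) (take _ u)).
by rewrite take_takel // {1}Eu take_size_cat // (catA (c :: t)) -Es.
Qed.

Lemma infix_catr w u y : w != [::] -> ~~ infix w u ->
  infix w (u ++ y) = infix w (take (head_overlap w u) w ++ y).
Proof.
move=> w0 Nwu; have rw0 : rev w != [::] by rewrite -size_eq0 size_rev size_eq0.
rewrite -infix_rev rev_cat infix_catl ?infix_rev //.
have := tail_overlap_lt (rev u) rw0; rewrite size_rev => /ltnW h_le.
by rewrite -infix_rev rev_cat revK drop_rev !revK subKn.
Qed.

(** An occurrence lying neither in [x ++ u] nor in [u ++ y] starts strictly before [u] and ends
    strictly after it, so it exhibits [u] strictly inside [w]. *)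
Lemma infix_catlr w x u y :
  (forall t s, t != [::] -> s != [::] -> w <> t ++ u ++ s) ->
  infix w (x ++ u ++ y) = infix w (x ++ u) || infix w (u ++ y).
Proof.
move=> Nwu; apply/idP/orP; last first.
  case=> /infix_trans; apply; apply/infixP.
    by exists [::], y; rewrite /= catA.
  by exists x, [::]; rewrite cats0.
case/infixP => p [q] /eq_cat_split[[t -> E]|[t _ E]]; last first.
  by right; apply/infixP; exists t, q.
move: E; rewrite catA => /esym/eq_cat_split[[s E _]|[s E Ey]].
  by left; rewrite -catA E; apply/infixP; exists p, s.
case: s E Ey => [|d s]; last case: t => [|c t].
- rewrite cats0 => -> _; left; apply/infixP; exists p, [::].
  by rewrite cats0 -catA.
- by move=> -> -> /=; right; apply/infixP; exists [::], q; rewrite -catA.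
- by rewrite -catA => /Nwu[].
Qed.

(** The test context is the prefix of [w] that the overlap of [u] completes to [w]; the overlap of
    [v] must then be long enough to leave room for [w]. *)
Lemma tail_overlap_le w u v : w != [::] -> ~~ infix w u -> ~~ infix w v ->
  (forall x, infix w (x ++ u) -> infix w (x ++ v)) ->
  tail_overlap w u <= tail_overlap w v.
Proof.
move=> w0 Nwu Nwv /(_ (take (size w - tail_overlap w u) w)).
rewrite infix_catl // cat_take_drop infix_refl => /(_ isT).
rewrite infix_catl // => /size_infix; rewrite size_cat size_drop size_take_min.
have := tail_overlap_lt u w0; have := tail_overlap_lt v w0; lia.
Qed.

(** * Words with prescribed overlaps *)

Lemma tail_overlap_cat_nseq w e i r : last e w != e -> i < size w ->
  tail_overlap w (drop (size w - i) w ++ nseq (size w) e ++ r) = i.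
Proof.
move=> we i_w; have sD : size (drop (size w - i) w) = i.
  by rewrite size_drop; lia.
apply/eqP; rewrite eqn_leq; apply/andP; split; last first.
  by apply: tail_overlap_max => //; rewrite -{1}sD take_size_cat.
(* An overlap of length [k > i] would end inside the block of [e], making [e] the last letter of
   [w]. *)
apply/bigmax_leqP => k /eqP E; rewrite leqNgt; apply: contraNN we => i_k.
have := congr1 (fun s => nth e s k.-1) E.
have k_w := ltn_ord k.
rewrite nth_take ?nth_drop ?nth_cat ?sD; last lia.
rewrite ltnNge (_ : i <= k.-1) /=; last lia.
rewrite size_nseq nth_nseq (_ : k.-1 - i < size w); last lia.
rewrite -nth_last => e_nth; rewrite [X in _ == X]e_nth; apply/eqP.
congr nth; lia.
Qed.

Lemma tail_overlap_nseq w e r : last e w != e ->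
  tail_overlap w (nseq (size w) e ++ r) = 0.
Proof.
move=> we; have := tail_overlap_cat_nseq (i := 0) r we.
by rewrite subn0 drop_size; apply; case: w we => //=; rewrite eqxx.
Qed.

Lemma head_overlap_cat_nseq w f j r : head f w != f -> j < size w ->
  head_overlap w (r ++ nseq (size w) f ++ take j w) = j.
Proof.
move=> wf j_w; rewrite /head_overlap !rev_cat rev_nseq -catA.
rewrite (_ : rev (take j w) = drop (size w - j) (rev w)).
  rewrite -(size_rev w) tail_overlap_cat_nseq ?size_rev //.
  by case: (w) wf => // c w' /=; rewrite rev_cons last_rcons.
by rewrite drop_rev subKn // ltnW.
Qed.

Lemma head_overlap_nseq w f r : head f w != f ->
  head_overlap w (r ++ nseq (size w) f) = 0.
Proof.
move=> wf; have := head_overlap_cat_nseq (j := 0) r wf.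
by rewrite take0 cats0; apply; case: w wf => //=; rewrite eqxx.
Qed.

(* The end blocks of z make its overlaps with w vanish, whatever surrounds
   them. *)
Definition separates w z := exists e f r r',
  [/\ last e w != e, head f w != f, z = nseq (size w) e ++ r,
      z = r' ++ nseq (size w) f & ~~ infix w z].

Section Bridge.
Variables (w z : seq T) (i j : nat).
Hypotheses (sep : separates w z) (i_w : i < size w) (j_w : j < size w).
Let u := drop (size w - i) w ++ z ++ take j w.

Lemma tail_overlap_bridge : tail_overlap w u = i.
Proof.
case: sep => e [f [r [r' [we wf zr zr' _]]]].
by rewrite /u zr -catA tail_overlap_cat_nseq.
Qed.

Lemma head_overlap_bridge : head_overlap w u = j.
Proof.
case: sep => e [f [r [r' [we wf zr zr' _]]]].
by rewrite /u zr' -catA catA head_overlap_cat_nseq.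
Qed.

(** Both overlaps of [z] vanish, so each of its two neighbours would have to contain [w] on its own,
    and both are too short. *)
Lemma infix_bridge : ~~ infix w u.
Proof.
case: sep => e [f [r [r' [we wf zr zr' Nwz]]]].
have w0 : w != [::] by case: (w) i_w.
have Nwzt : ~~ infix w (z ++ take j w).
  rewrite infix_catr // zr' head_overlap_nseq // take0 /=.
  by apply/negP => /size_infix; rewrite size_take j_w leqNgt j_w.
rewrite /u infix_catl // zr -catA tail_overlap_nseq // subn0 drop_size cats0.
by apply/negP => /size_infix; rewrite size_drop; lia.
Qed.

(** This keeps bridges from being inner factors. *)
Lemma size_bridge : size w <= size u.
Proof.
case: sep => e [f [r [r' [_ _ zr _ _]]]].
by rewrite /u zr !size_cat size_nseq -addnA addnCA leq_addr.
Qed.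

End Bridge.

(** * Existence of a separating word *)

Lemma infix_nseq w (c : T) m : infix w (nseq m c) -> w = nseq (size w) c.
Proof.
move=> w_nseq; apply/all_pred1P/allP => x /(mem_infix w_nseq).
by rewrite mem_nseq => /andP[].
Qed.

Lemma infix_nseq_cat w (c d : T) m m' : infix w (nseq m c ++ nseq m' d) ->
  exists k l, w = nseq k c ++ nseq l d.
Proof.
case/infixP => p [q] /eq_cat_split[[t cE]|[t _ dE]]; last first.
  exists 0, (size w); apply: (@infix_nseq _ _ m').
  by apply/infixP; exists t, q.
have tE : t = nseq (size t) c.
  by apply: (@infix_nseq _ _ m); apply/infixP; exists p, [::]; rewrite cats0.
case/eq_cat_split => -[s wE dE].
  exists (size t), (size s); rewrite wE {1}tE; congr (_ ++ _).
  by apply: (@infix_nseq _ _ m'); apply/infixP; exists [::], q.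
exists (size w), 0; rewrite cats0; apply: (@infix_nseq _ _ (size t)).
by apply/infixP; exists [::], s; rewrite -tE.
Qed.

(** The letter [c] sits exactly at the positions below [m] and at [m + 1]. In a factor [ccdd] the
    second [c] would be at [m - 1], but then the last [d] falls on [m + 1]. *)
Lemma infix_ccdd (c d : T) m m' : c != d ->
  ~~ infix ([:: c; c; d; d] : seq T) (nseq m c ++ [:: d; c] ++ nseq m' d).
Proof.
move=> cd; apply/negP => /infixP[p [q E]].
have N k : k < 4 ->
    nth d (nseq m c ++ [:: d; c] ++ nseq m' d) (size p + k) =
    nth d [:: c; c; d; d] k.
  move=> k4; rewrite E nth_cat ltnNge leq_addr addKn.
  by case: k k4 => [|[|[|[|k]]]].
have dc : (d == c) = false by rewrite eq_sym (negbTE cd).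
(* With default [d], the formula also holds past the end of the word. *)
have zE k : (nth d (nseq m c ++ [:: d; c] ++ nseq m' d) k == c) =
    (k < m) || (k == m.+1).
  rewrite nth_cat size_nseq nth_nseq; case: ltnP => [_|m_k]; first exact: eqxx.
  rewrite -{2}(subnKC m_k); case: (k - m) => [|[|l]] /=.
  - by rewrite dc addn0; lia.
  - by rewrite eqxx addn1 eqxx.
  - by rewrite nth_nseq if_same dc; lia.
have := zE (size p + 0); have := zE (size p + 1); have := zE (size p + 2).
have := zE (size p + 3).
by rewrite !N //= dc eqxx; lia.
Qed.

Lemma separates_ex (a b : T) w : a != b -> {subset w <= [:: a; b]} ->
  w != [::] ->
  w \notin [:: rcons (nseq (size w).-1 a) b; a :: nseq (size w).-1 b;
               b :: nseq (size w).-1 a; rcons (nseq (size w).-1 b) a] ->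
  exists z, separates w z.
Proof.
move=> ab w_ab w0 w_excl; pose c := head a w; pose d := last a w.
have cE e : head e w = c by rewrite /c; case: (w) w0.
have dE e : last e w = d by rewrite /d; case: (w) w0.
have cw : c \in w by rewrite /c; case: (w) w0 => // y s _; rewrite mem_head.
have dw : d \in w by rewrite /d; case: (w) w0 => // y s _; rewrite /= mem_last.
have [cd|c_d] := eqVneq c d.
  have [e ec] : exists e, c != e.
    by have [->|] := eqVneq c a; [exists b|exists a].
  exists (nseq (size w) e), e, e, [::], [::].
  split; rewrite ?cE ?dE ?cats0 -?cd //.
  apply/negP => /mem_infix/(_ _ cw); rewrite mem_nseq (negbTE ec).
  by rewrite andbF.
have cd_ab : (c = a /\ d = b) \/ (c = b /\ d = a).
  move: (w_ab _ cw) (w_ab _ dw) c_d; rewrite !inE.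
  by do 2![case/orP => /eqP->]; rewrite ?eqxx; auto.
have sep_cd s : ~~ infix w (nseq (size w) c ++ s ++ nseq (size w) d) ->
    separates w (nseq (size w) c ++ s ++ nseq (size w) d).
  move=> Nw; exists c, d, (s ++ nseq (size w) d), (nseq (size w) c ++ s).
  by rewrite cE dE eq_sym c_d -catA.
have [|] := boolP (infix w (nseq (size w) c ++ nseq (size w) d)); last first.
  by move=> /(sep_cd [::]); exists (nseq (size w) c ++ nseq (size w) d).
move=> /infix_nseq_cat[k [l wE]].
exists (nseq (size w) c ++ [:: d; c] ++ nseq (size w) d); apply: sep_cd.
(* Now [w] is [c^k d^l]: exponent 0 contradicts the first or last letter, exponent 1 gives an
   excluded word, and otherwise [ccdd] is a factor of [w]. *)
case: k wE => [|[|k]] wE.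
- by move: c_d; rewrite -(cE d) wE; case: (l) => [|l'] /=; rewrite eqxx.
- case/negP: w_excl; rewrite wE /= size_nseq.
  by rewrite !inE; case: cd_ab => -[-> ->]; rewrite eqxx ?orbT.
case: l wE => [|[|l]] wE.
- by move: dw; rewrite wE cats0 mem_nseq /= eq_sym (negbTE c_d).
- case/negP: w_excl; rewrite wE cats1 size_rcons size_nseq.
  by rewrite !inE; case: cd_ab => -[-> ->]; rewrite eqxx ?orbT.
have : infix [:: c; c; d; d] w.
  apply/infixP; exists (nseq k c), (nseq l d); rewrite wE.
  by rewrite -(addn2 k) nseqD -catA.
move/infix_trans => ccdd_trans.
by apply: contraNN (infix_ccdd (size w) (size w) c_d) => /ccdd_trans.
Qed.

End Overlap.

(** Reduces the count to a finite system of representatives, so that the quotient itself need not be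
    handled again. *)
Lemma synt_complexity_card (Sigma : finType) (L : set (seq Sigma))
    (I : finType) (g : I -> seq Sigma) :
  (forall i, g i != [::]) ->
  (forall i j, synt_congr L (g i) (g j) -> i = j) ->
  (forall u, u != [::] -> exists i, synt_congr L u (g i)) ->
  synt_complexity L #|I|.
Proof.
move=> g0 g_inj g_surj.
pose c i := (\pi_(synt_semigroup L) (exist _ (g i) (g0 i) : nword Sigma))%qT.
have c_inj : injective c.
  by move=> i j /(eqquotP (synt_semigroup L))/asboolP/g_inj.
rewrite /synt_complexity.
rewrite (_ : [set: _]%classic = [set` [fset c i | i in I]%fset]%classic).
  apply/card_eq_fsetP; rewrite card_imfset //= cardE.
  by congr size; apply/eq_enum.
apply/seteqP; split=> // s _; elim/quotW: s => u.
case: (g_surj _ (valP u)) => i ui; apply/imfsetP; exists i => //.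
by apply/(eqquotP (synt_semigroup L))/asboolP.
Qed.

(** * The syntactic congruence of the words containing [w] *)

Section FactorLanguage.
Variables (Sigma : finType) (w : seq Sigma).
Implicit Types u v : seq Sigma.

Local Notation congr := (synt_congr (factor_language w)).

Lemma congrP u v :
  congr u v <-> forall x y, infix w (x ++ u ++ y) = infix w (x ++ v ++ y).
Proof.
have LE s : factor_language w s <-> infix w s by split=> /infixP.
split=> uv x y; last by rewrite !LE uv.
by apply/idP/idP => /LE/uv/LE.
Qed.

Lemma congr_sym u v : congr u v -> congr v u.
Proof. by move=> uv x y; rewrite uv. Qed.

Lemma congr_infix u v : congr u v -> infix w u = infix w v.
Proof. by move=> /congrP/(_ [::] [::]); rewrite !cats0. Qed.

Lemma infix_congr u v : infix w u -> infix w v -> congr u v.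
Proof.
have wide s x y : infix w s -> infix w (x ++ s ++ y).
  by move=> /infix_trans; apply; apply/infixP; exists x, y.
by move=> wu wv; apply/congrP => x y; rewrite !wide.
Qed.

Lemma inner_factor_size u : inner_factor w u -> size u < size w.
Proof.
by case=> _ [[|c t] [[|d s] [// _ _ ->]]]; rewrite /= !size_cat /=; lia.
Qed.

Lemma inner_factor_infix u : inner_factor w u -> ~~ infix w u.
Proof.
by move=> /inner_factor_size u_w; apply/negP => /size_infix; rewrite leqNgt u_w.
Qed.

(** Write [w = t ++ u ++ s]. If [v] were not inner, [w] would occur in [t ++ v] or [v ++ s], hence
    in [t ++ u] or [u ++ s], which are shorter than [w]. *)
Lemma congr_inner u v : v != [::] -> inner_factor w u -> congr u v ->
  inner_factor w v.
Proof.
move=> v0 iu uv; apply: contrapT => Niv.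
case: (iu) => _ [t [s [t0 s0 wE]]]; have /congrP/(_ t s) := uv.
rewrite -wE infix_refl infix_catlr; last first.
  by move=> t' s' t0' s0' E; apply: Niv; split=> //; exists t', s'.
have /congrP := uv => uvE.
have := uvE t [::]; have := uvE [::] s; rewrite !cats0 /= => <- <- /esym.
have tu_lt : size (t ++ u) < size w.
  rewrite wE catA [leqRHS]size_cat; case: (s) s0 => // d s' _.
  by rewrite addnS leq_addr.
have us_lt : size (u ++ s) < size w.
  rewrite wE [leqRHS]size_cat; case: (t) t0 => // d t' _.
  by rewrite ltnS leq_addl.
by case/orP => /size_infix; rewrite leqNgt (tu_lt, us_lt).
Qed.

(** Both words are inner, so each is at most as long as the other; then [t ++ v ++ s] contains [w]
    and has its length, so it is [w]. *)
Lemma congr_inner_eq u v : v != [::] -> inner_factor w u -> congr u v -> u = v.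
Proof.
have size_le u' v' : inner_factor w u' -> congr u' v' -> size u' <= size v'.
  case=> _ [t [s [_ _ wE]]] /congrP/(_ t s).
  rewrite -wE infix_refl => /esym/size_infix.
  by rewrite {1}wE !size_cat leq_add2l leq_add2r.
move=> v0 iu uv; have iv := congr_inner v0 iu uv.
have uv_size : size u = size v.
  by apply/eqP; rewrite eqn_leq !size_le //; exact: congr_sym.
case: iu => _ [t [s [_ _ wE]]]; have /congrP/(_ t s) := uv.
rewrite -wE infix_refl => /esym/infix_size_eq.
rewrite {1 2}wE !size_cat uv_size => /(_ (leqnn _))/eqP.
by rewrite eqseq_cat // eqxx eqseq_cat //= => /andP[/eqP].
Qed.

Hypothesis w0 : w != [::].

Lemma congr_tail_overlap u v : congr u v -> ~~ infix w u ->
  tail_overlap w u = tail_overlap w v.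
Proof.
move=> uv Nwu; have Nwv : ~~ infix w v by rewrite -(congr_infix uv).
have /congrP uvE := uv.
by apply/eqP; rewrite eqn_leq !tail_overlap_le // => x;
  have := uvE x [::]; rewrite !cats0 => ->.
Qed.

Lemma congr_head_overlap u v : congr u v -> ~~ infix w u ->
  head_overlap w u = head_overlap w v.
Proof.
move=> uv Nwu; have Nwv : ~~ infix w v by rewrite -(congr_infix uv).
have /congrP uvE := uv; have rw0 : rev w != [::].
  by rewrite -size_eq0 size_rev size_eq0.
by apply/eqP; rewrite eqn_leq !tail_overlap_le ?infix_rev // => x;
  rewrite -{1 2}[x]revK -!rev_cat !infix_rev;
  have /= -> := uvE [::] (rev x).
Qed.

Lemma overlap_congr u v : u != [::] -> v != [::] ->
  ~~ infix w u -> ~~ infix w v -> ~ inner_factor w u -> ~ inner_factor w v ->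
  tail_overlap w u = tail_overlap w v -> head_overlap w u = head_overlap w v ->
  congr u v.
Proof.
move=> u0 v0 Nwu Nwv Niu Niv tuv huv; apply/congrP => x y.
have catE s : s != [::] -> ~ inner_factor w s ->
    infix w (x ++ s ++ y) = infix w (x ++ s) || infix w (s ++ y).
  move=> s0 Nis; apply: infix_catlr => t r t0 r0 E.
  by apply: Nis; split=> //; exists t, r.
rewrite !catE // (infix_catl x w0 Nwu) (infix_catl x w0 Nwv) tuv.
by rewrite (infix_catr y w0 Nwu) (infix_catr y w0 Nwv) huv.
Qed.

End FactorLanguage.

(** * Counting the classes *)

Theorem theorem1 (Sigma : finType) (a b : Sigma) (ab : a != b)
    (SigmaE : forall c : Sigma, c \in [:: a; b])
    (w : seq Sigma) (n : nat) (sz_w : size w = n) (w_neq0 : w != [::])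
    (w_excl : w \notin [:: rcons (nseq n.-1 a) b; a :: nseq n.-1 b;
                           b :: nseq n.-1 a; rcons (nseq n.-1 b) a]) :
  synt_complexity (factor_language w) (n ^ 2 + 1 + num_inner_factors w).
Proof.
subst n; have [z sep] := separates_ex ab (fun c _ => SigmaE c) w_neq0 w_excl.
set n := size w.
pose F := fset_set [set u | inner_factor w u]%classic.
have inF u : reflect (inner_factor w u) (u \in F).
  rewrite (in_fset_set (@finite_inner_factor _ w)).
  by apply: (iffP idP); rewrite inE.
pose bridge (i j : 'I_n) := drop (n - i) w ++ z ++ take j w.
(* One representative per class: [w] for the words containing it, a bridge for each pair of
   overlaps, and each inner factor for itself. *)
pose g (k : option ('I_n * 'I_n + F)) := match k with
  | None => w
  | Some (inl (i, j)) => bridge i j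
  | Some (inr f) => val f
  end.
have n_gt0 : 0 < n by rewrite lt0n size_eq0.
have Nw_bridge i j : ~~ infix w (bridge i j) by apply: infix_bridge.
have Ni_bridge i j : ~ inner_factor w (bridge i j).
  by move=> /inner_factor_size; rewrite ltnNge (size_bridge i j sep).
have bridge0 i j : bridge i j != [::].
  by rewrite -size_eq0 -lt0n (leq_trans n_gt0) // (size_bridge i j sep).
have iF (f : F) : inner_factor w (val f) by apply/inF/fsvalP.
have g0 k : g k != [::] by case: k => [[[i j]|f]|] //=; case: (iF f).
rewrite (_ : n ^ 2 + 1 + _ = #|{: option ('I_n * 'I_n + F)}|); last first.
  by rewrite card_option card_sum card_prod card_ord -cardfE mulnn addn1.
apply: (synt_complexity_card g0) => [k l kl|u u0].
- have := congr_infix kl; case: k l kl => [[[i j]|f]|] [[[i' j']|f']|] //=.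
  + move=> kl _; have := congr_tail_overlap w_neq0 kl (Nw_bridge i j).
    have := congr_head_overlap w_neq0 kl (Nw_bridge i j).
    rewrite !tail_overlap_bridge // !head_overlap_bridge //.
    by move=> /val_inj-> /val_inj->.
  + move=> /congr_sym/(congr_inner_eq (bridge0 i j) (iF f')) fE.
    by case: (Ni_bridge i j); rewrite -fE.
  + by rewrite infix_refl (negbTE (Nw_bridge i j)).
  + move=> /(congr_inner_eq (bridge0 i' j') (iF f)) fE.
    by case: (Ni_bridge i' j'); rewrite -fE.
  + case: (iF f') => f'0 _ /(congr_inner_eq f'0 (iF f))/val_inj->.
    by [].
  + by rewrite infix_refl (negbTE (inner_factor_infix (iF f))).
  + by rewrite infix_refl (negbTE (Nw_bridge i' j')).
  + by rewrite infix_refl (negbTE (inner_factor_infix (iF f'))).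
- have [wu|Nwu] := boolP (infix w u).
    by exists None; apply: infix_congr => //; apply: infix_refl.
  have [/inF uF|Niu] := pselect (inner_factor w u).
    by exists (Some (inr [` uF]%fset)).
  (* The remaining words are congruent to the bridge built from their own two overlaps. *)
  have i_n := tail_overlap_lt u w_neq0.
  have j_n : head_overlap w u < n.
    by rewrite /n -size_rev tail_overlap_lt // -size_eq0 size_rev size_eq0.
  exists (Some (inl (Ordinal i_n, Ordinal j_n))).
  apply: overlap_congr => //=.
    by rewrite tail_overlap_bridge.
  by rewrite head_overlap_bridge.
Qed.
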